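(* Let $m\ge2$ and let $\sigma:(0,\infty)\to(0,\infty)$ be smooth. A radial function $f=f(r)$ on the model space $(\mathbb{R}^+\times S^{m-1},\, dr^2+\sigma^2(r)\,g^{S^{m-1}})$ is biharmonic if and only if there are constants $c_1,c_2,c_3,c_4\in\mathbb{R}$ such that $$\begin{aligned} f(r)=\;& c_4+ c_3\int \frac{1}{\sigma^{m-1}}\,dr +c_2\Big[\int \frac{1}{\sigma^{m-1}}\,dr\,\int \sigma^{m-1}\, dr-\int \Big(\int \frac{1}{\sigma^{m-1}}\,dr\Big)\sigma^{m-1}\,dr\Big]\\ &+c_1\Big[ \int \frac{1}{\sigma^{m-1}}\,dr\,\int \Big(\int \frac{1}{\sigma^{m-1}}\,dr\Big)\sigma^{m-1}\,dr-\int \Big(\int \frac{1}{\sigma^{m-1}}\,dr\Big)^2\sigma^{m-1}\,dr\Big]. \end{aligned}$$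
   Context: $\mathbb{R}^+=(0,\infty)$ and $g^{S^{m-1}}$ is the standard metric of the unit sphere $S^{m-1}$. A radial function is a smooth function on the model space depending only on $r$. With $\Delta f=\operatorname{div}(\nabla f)$, a function is biharmonic if $\Delta^2f=\Delta(\Delta f)=0$. Each indefinite integral denotes an arbitrarily chosen but fixed antiderivative on $(0,\infty)$, with the same antiderivative used at every occurrence of the same integrand. *)

(* Defs.v *)
From HB Require Import structures.
From mathcomp Require Import all_boot all_order all_algebra.
From mathcomp Require Import all_classical all_reals all_analysis.

Set Implicit Arguments.
Unset Strict Implicit.
Unset Printing Implicit Defensive.

Import Order.TTheory GRing.Theory Num.Theory.
Import numFieldNormedType.Exports.

Local Open Scope classical_set_scope.
Local Open Scope ring_scope.

Section Smooth.
Context {R : realType}.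

Definition iter_derive (V W : normedModType R) (vs : seq V) (f : V -> W) :
    V -> W :=
  foldr (fun v g x => 'D_v g x) f vs.

(* C^oo on U (meant for open U and finite-dimensional V): the iterated
   directional derivatives of every order are differentiable on U. *)
Definition smooth_on (V W : normedModType R) (U : set V) (f : V -> W) : Prop :=
  forall (vs : seq V) (x : V), U x -> differentiable (iter_derive vs f) x.

Definition antiderivative (g G : R -> R) : Prop :=
  forall r : R, 0 < r -> is_derive r (1 : R) G (g r).

End Smooth.

(* Riemannian geometry in a coordinate domain of R^k, the metric being given
   by its Gram matrix (g_ij) = G u at the point u. *)
Section Coordinates.
Context {R : realType}.

Definition partial (k : nat) (W : normedModType R) (i : 'I_k)
    (f : 'rV[R]_k -> W) (u : 'rV[R]_k) : W :=
  'D_(delta_mx 0 i : 'rV[R]_k) f u.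

Definition vol_density (k : nat) (G : 'rV[R]_k -> 'M[R]_k) (u : 'rV[R]_k) : R :=
  Num.sqrt (\det (G u)).

Definition gradient (k : nat) (G : 'rV[R]_k -> 'M[R]_k) (f : 'rV[R]_k -> R)
    (u : 'rV[R]_k) : 'rV[R]_k :=
  \row_i \sum_j invmx (G u) i j * partial j f u.

(* div X is the function with L_X vol = (div X) vol, where
   vol = sqrt(det g) du_1 ... du_k. *)
Definition divergence (k : nat) (G : 'rV[R]_k -> 'M[R]_k)
    (X : 'rV[R]_k -> 'rV[R]_k) (u : 'rV[R]_k) : R :=
  (vol_density G u)^-1 *
  \sum_i partial i (fun v => vol_density G v * X v 0 i : R) u.

Definition coord_laplacian (k : nat) (G : 'rV[R]_k -> 'M[R]_k)
    (f : 'rV[R]_k -> R) : 'rV[R]_k -> R :=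
  divergence G (gradient G f).

End Coordinates.

(* The model space R^+ x S^(m-1) is the set of pairs (r, theta) in R x R^m
   with r > 0 and theta on the Euclidean unit sphere; its tangent vectors are
   pairs (a, v) in R x R^m with v orthogonal to theta. *)
Section ModelSpace.
Context {R : realType} {m : nat}.

Definition dot (v w : 'rV[R]_m) : R := \sum_i v 0 i * w 0 i.

Definition unit_sphere : set 'rV[R]_m := [set theta | dot theta theta = 1].

Definition model_space : set (R * 'rV[R]_m) :=
  [set p | 0 < p.1 /\ unit_sphere p.2].

(* dr^2 + sigma(r)^2 g^S at the point p; the standard metric g^S is the
   restriction of the Euclidean dot product. *)
Definition model_metric (sigma : R -> R) (p X Y : R * 'rV[R]_m) : R :=
  X.1 * Y.1 + sigma p.1 ^+ 2 * dot X.2 Y.2.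

(* Local parametrizations of S^(m-1), i.e. inverses of its charts: between
   manifolds of the same dimension an injective immersion is a diffeomorphism
   onto an open subset. *)
Definition sphere_param (V : set 'rV[R]_m.-1) (psi : 'rV[R]_m.-1 -> 'rV[R]_m) :
    Prop :=
  [/\ open V,
      smooth_on V psi,
      {in V &, injective psi},
      forall y, V y -> unit_sphere (psi y) &
      forall y, V y -> row_free ('J psi y)].

(* The product atlas: coordinates u = (r, y) on R^+ x V parametrize
   (r, psi y). *)
Definition param_domain (V : set 'rV[R]_m.-1) : set 'rV[R]_(1 + m.-1) :=
  [set u | 0 < lsubmx u 0 0 /\ V (rsubmx u)].

Definition model_param (psi : 'rV[R]_m.-1 -> 'rV[R]_m)
    (u : 'rV[R]_(1 + m.-1)) : R * 'rV[R]_m :=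
  (lsubmx u 0 0, psi (rsubmx u)).

Definition pullback_metric (sigma : R -> R) (psi : 'rV[R]_m.-1 -> 'rV[R]_m)
    (u : 'rV[R]_(1 + m.-1)) : 'M[R]_(1 + m.-1) :=
  \matrix_(i, j) model_metric sigma (model_param psi u)
    (partial i (model_param psi) u) (partial j (model_param psi) u).

Definition smooth_on_model (f : R * 'rV[R]_m -> R) : Prop :=
  forall V psi, sphere_param V psi ->
    smooth_on (param_domain V) (f \o model_param psi : _ -> R).

Definition radial (f : R * 'rV[R]_m -> R) : Prop :=
  smooth_on_model f /\
  forall p q, model_space p -> model_space q -> p.1 = q.1 -> f p = f q.

(* Delta f = h on the model space. The Laplacian is a relation because it is
   computed in coordinates: h must represent it in every parametrization of
   the product atlas. Values off the model space are irrelevant. *)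
Definition is_laplacian (sigma : R -> R) (f h : R * 'rV[R]_m -> R) : Prop :=
  forall V psi, sphere_param V psi -> forall u, param_domain V u ->
    h (model_param psi u) =
    coord_laplacian (pullback_metric sigma psi) (f \o model_param psi) u.

Definition biharmonic (sigma : R -> R) (f : R * 'rV[R]_m -> R) : Prop :=
  exists h, is_laplacian sigma f h /\ is_laplacian sigma h (fun=> 0).

End ModelSpace.

(* Main.v *)
(* A function F of r alone has Laplacian (w F')' / w, where w = sigma^(m-1): in
   the coordinates (r, y) the metric is block diagonal with blocks 1 and
   sigma(r)^2 times the Gram matrix of the sphere, so only the r-component of
   the gradient survives and the spherical factor of the volume density cancels.
   Hence f is biharmonic iff H := (w F')' / w satisfies (w H')' = 0, and
   integrating four times gives w H' = c1, H = c2 + c1 I1,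
   w F' = c3 + c2 I2 + c1 I3 and finally the formula for F. One nonempty chart
   is enough to extract the differential equation; stereographic projection is
   used. *)
Require Import Defs.
From mathcomp Require Import all_boot all_order all_algebra.
From mathcomp Require Import all_classical all_reals all_analysis.
From mathcomp Require Import ring lra.
Import Order.TTheory GRing.Theory Num.Theory.
Import numFieldNormedType.Exports.
Local Open Scope classical_set_scope.
Local Open Scope ring_scope.

(** * Positivity of Gram determinants *)

Lemma mul_rV_tr_ge0 (R : realDomainType) n (u : 'rV[R]_n) :
  0 <= (u *m u^T) 0 0.
Proof. by rewrite mxE sumr_ge0// => i _; rewrite mxE -expr2 sqr_ge0. Qed.

Lemma mul_rV_tr_eq0 (R : realDomainType) n (u : 'rV[R]_n) :
  (u *m u^T) 0 0 = 0 -> u = 0.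
Proof.
rewrite mxE => /eqP; rewrite psumr_eq0; last first.
  by move=> i _; rewrite mxE -expr2 sqr_ge0.
move=> /allP u0; apply/rowP => i; rewrite [RHS]mxE; apply/eqP.
by have := u0 i (mem_index_enum i); rewrite mxE -expr2 sqrf_eq0.
Qed.

(* Along the segment from the identity to J J^T the determinant does not
   vanish, because every matrix on it is positive definite. *)
Lemma det_gram_gt0 (R : rcfType) k n (J : 'M[R]_(k, n)) :
  row_free J -> 0 < \det (J *m J^T).
Proof.
move=> freeJ; set A := J *m J^T.
pose S (t : R) := t *: (A - 1%:M) + 1%:M.
have S_neq0 t : 0 <= t <= 1 -> \det (S t) != 0.
  move=> /andP[t0 t1]; apply/det0P => -[u u0 uS].
  have : (u *m S t *m u^T) 0 0 = 0 by rewrite uS mul0mx mxE.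
  (* Expanding, [u *m S t *m u^T] is t |uJ|^2 + (1 - t) |u|^2. Both squares are positive for u
     nonzero, since [J] is row free, so this convex combination cannot vanish. *)
  rewrite /S mulmxDr mulmx1 -scalemxAr mulmxBr mulmx1 mulmxDl -scalemxAl.
  rewrite mulmxBl /A mulmxA -[u *m J *m J^T *m u^T]mulmxA -trmx_mul.
  have := mul_rV_tr_ge0 _ _ u; have := mul_rV_tr_ge0 _ _ (u *m J).
  rewrite !mxE; set a := \sum_i _; set b := \sum_i _ => a0 b0 ab0.
  have b1 : b = 0 -> False.
    by move=> b_eq0; case/eqP: u0; apply: mul_rV_tr_eq0; rewrite mxE.
  have a1 : a = 0 -> False.
    move=> a_eq0; case/eqP: u0; apply: (row_free_inj freeJ).
    by rewrite mul0mx; apply: mul_rV_tr_eq0; rewrite mxE.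
  have {}a0 : 0 < a by rewrite lt_neqAle a0 eq_sym andbT; apply/eqP.
  have {}b0 : 0 < b by rewrite lt_neqAle b0 eq_sym andbT; apply/eqP.
  nra.
(* The determinant along the segment is a polynomial in t with value 1 at 0. Were \det A <= 0, the
   intermediate value theorem would give a root in [0, 1]; the sign of [q] is flipped to match the
   form of [poly_ivt]. *)
pose q := \det ('X *: map_mx polyC (A - 1%:M) + 1%:M).
have qE t : q.[t] = \det (S t).
  rewrite /q -horner_evalE -det_map_mx; congr (\det _).
  apply/matrixP => i j; rewrite !mxE -[LHS]/(horner _ t).
  by case: (i == j); rewrite ?mulr1n ?mulr0n !hornerE.
rewrite ltNge; apply/negP => detA0.
have [||t t01 /rootP] := @poly_ivt _ (- q) 0 1; first exact: ler01.
  rewrite !hornerN !qE /S scale0r add0r det1 scale1r subrK.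
  by rewrite oppr_le0 ler01 oppr_ge0.
rewrite hornerN qE => /eqP; rewrite oppr_eq0 => S0.
by have := S_neq0 t t01; rewrite S0.
Qed.

(** * Calculus of smooth functions on open sets *)

Lemma near_eq_differentiable (R : numFieldType) (V W : normedModType R)
    (f g : V -> W) (x : V) :
  {near x, f =1 g} -> differentiable f x -> differentiable g x.
Proof.
move=> fg df; have fgx := nbhs_singleton fg.
have dfc : continuous ('d f x) by exact: diff_continuous.
(* The first-order expansion of f at x involves only values near x, so it is also one for g;
   uniqueness of the differential then identifies 'd g x with 'd f x. *)
suff gE : g \o shift x = cst (g x) + 'd f x +o_ 0 id.
  by apply/diff_locallyP; rewrite (diff_unique dfc gE).
apply/eqaddoP => e e0.
have /eqaddoP/(_ e e0) := diff_locally df.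
apply: filter_app.
have : \forall h \near 0, f (h + x) = g (h + x).
  by rewrite (near_shift x 0)/=; apply: filterS fg => z;
    rewrite sub0r /= addrNK.
apply: filterS => h fgh.
by rewrite !fctE /= fgh fgx.
Qed.

Section SmoothOn.
Context {R : realType} {V : normedModType R}.
Implicit Types (U : set V) (f g : V -> R).

(** In [iter_derive] the last vector of the list is differentiated first. Peeling it off expresses
    smoothness of f through smoothness of its first derivatives. *)
Lemma iter_derive_rcons (W : normedModType R) (vs : seq V) (v : V)
    (f : V -> W) :
  iter_derive (rcons vs v) f = iter_derive vs (fun x => 'D_v f x).
Proof. by rewrite /iter_derive foldr_rcons. Qed.

Lemma smooth_on_differentiable (W : normedModType R) U (f : V -> W) x :
  smooth_on U f -> U x -> differentiable f x.
Proof. by move=> /(_ [::] x). Qed.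

Lemma smooth_on_derive (W : normedModType R) U (f : V -> W) v :
  smooth_on U f -> smooth_on U (fun x => 'D_v f x).
Proof. by move=> sf vs x Ux; rewrite -iter_derive_rcons; exact: sf. Qed.

Lemma smooth_onP (W : normedModType R) U (f : V -> W) :
  (forall x, U x -> differentiable f x) ->
  (forall v, smooth_on U (fun x => 'D_v f x)) -> smooth_on U f.
Proof.
move=> df sDf vs x Ux; case/lastP: vs => [|vs v]; first exact: df.
by rewrite iter_derive_rcons; exact: sDf.
Qed.

Lemma smooth_on_cst (W : normedModType R) U (c : W) : smooth_on U (fun=> c).
Proof.
move=> vs x _.
suff [d ->] : exists d : W, iter_derive vs (fun=> c) = cst d by [].
elim: vs => [|v vs [d IH]] /=; first by exists c.
by exists 0; rewrite IH; apply/funext => y; rewrite derive_cst.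
Qed.

(* The Leibniz and quotient rules make this class stable under directional
   derivatives, so that all its members are smooth. *)
Inductive smooth_alg U : (V -> R) -> Prop :=
| smooth_alg_base f of smooth_on U f : smooth_alg U f
| smooth_algD f g of smooth_alg U f & smooth_alg U g : smooth_alg U (f + g)
| smooth_algM f g of smooth_alg U f & smooth_alg U g : smooth_alg U (f * g)
| smooth_algV f of smooth_alg U f & (forall x, U x -> f x != 0) :
    smooth_alg U (fun x => (f x)^-1)
| smooth_alg_eq f g of smooth_alg U f & (forall x, U x -> f x = g x) :
    smooth_alg U g.

(** Induction on the construction of f. Each derivative rule writes 'D_v f with members of the
    class. Openness of U enters in the last case, where agreement on U has to give agreement near
    each point. *)
Lemma smooth_alg_diff U f : open U -> smooth_alg U f ->
  (forall x, U x -> differentiable f x) /\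
  (forall v, smooth_alg U (fun x => 'D_v f x)).
Proof.
move=> oU; elim=> {f}
  [f sf|f g sf [df Df] sg [dg Dg]|f g sf [df Df] sg [dg Dg]|f sf [df Df] f0|
   f g sf [df Df] fg].
- split=> [x|v]; first exact: smooth_on_differentiable.
  exact/smooth_alg_base/smooth_on_derive.
- split=> [x Ux|v]; first by apply: differentiableD; [exact: df|exact: dg].
  apply: smooth_alg_eq (smooth_algD _ _ _ (Df v) (Dg v)) _ => x Ux.
  by rewrite deriveD//; apply: diff_derivable; [exact: df|exact: dg].
- split=> [x Ux|v]; first by apply: differentiableM; [exact: df|exact: dg].
  apply: smooth_alg_eq (smooth_algD _ _ _ (smooth_algM _ _ _ sf (Dg v))
    (smooth_algM _ _ _ sg (Df v))) _ => x Ux.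
  by rewrite deriveM//; apply: diff_derivable; [exact: df|exact: dg].
- split=> [x Ux|v]; first by apply: differentiableV; [exact: df|exact: f0].
  have s1 := smooth_alg_base _ _ (smooth_on_cst R U (-1)).
  have sV := smooth_algV _ _ sf f0.
  apply: smooth_alg_eq (smooth_algM _ _ _ s1 (smooth_algM _ _ _
    (smooth_algM _ _ _ sV sV) (Df v))) _ => x Ux.
  rewrite deriveV; [|exact: f0|exact/diff_derivable/df].
  by rewrite !fctE /= expr2 invfM mulN1r -mulNr.
- have nfg x : U x -> {near x, f =1 g}.
    by move=> Ux; apply: filterS (open_nbhs_nbhs (conj oU Ux)).
  split=> [x Ux|v]; first exact: near_eq_differentiable (nfg x Ux) (df x Ux).
  by apply: smooth_alg_eq (Df v) _ => x Ux; apply: near_eq_derive; exact: nfg.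
Qed.

Lemma smooth_alg_smooth_on U f : open U -> smooth_alg U f -> smooth_on U f.
Proof.
move=> oU sf vs x; apply: (proj1 (smooth_alg_diff _ _ oU _)).
by elim: vs => //= v vs IH; exact: (proj2 (smooth_alg_diff _ _ oU IH)).
Qed.

Lemma smooth_on_eq U f g : open U -> (forall x, U x -> f x = g x) ->
  smooth_on U f -> smooth_on U g.
Proof.
move=> oU fg sf; apply: smooth_alg_smooth_on => //.
exact: smooth_alg_eq (smooth_alg_base _ _ sf) fg.
Qed.

Lemma smooth_onD U f g : open U -> smooth_on U f -> smooth_on U g ->
  smooth_on U (fun x => f x + g x).
Proof.
move=> oU sf sg; apply: smooth_alg_smooth_on => //.
exact: smooth_algD (smooth_alg_base _ _ sf) (smooth_alg_base _ _ sg).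
Qed.

Lemma smooth_onM U f g : open U -> smooth_on U f -> smooth_on U g ->
  smooth_on U (fun x => f x * g x).
Proof.
move=> oU sf sg; apply: smooth_alg_smooth_on => //.
exact: smooth_algM (smooth_alg_base _ _ sf) (smooth_alg_base _ _ sg).
Qed.

Lemma smooth_onV U f : open U -> (forall x, U x -> f x != 0) ->
  smooth_on U f -> smooth_on U (fun x => (f x)^-1).
Proof.
move=> oU f0 sf; apply: smooth_alg_smooth_on => //.
exact: smooth_algV (smooth_alg_base _ _ sf) f0.
Qed.

Lemma smooth_onX U f n : open U -> smooth_on U f ->
  smooth_on U (fun x => f x ^+ n).
Proof.
move=> oU sf; elim: n => [|n IH]; first exact: smooth_on_cst.
by under eq_fun do rewrite exprS; exact: smooth_onM.
Qed.

Lemma smooth_on_sum U n (f : 'I_n -> V -> R) : open U ->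
  (forall i, smooth_on U (f i)) -> smooth_on U (fun x => \sum_i f i x).
Proof.
move=> oU; elim: n f => [|n IH] f sf.
  by under eq_fun do rewrite big_ord0; exact: smooth_on_cst.
by under eq_fun do rewrite big_ord_recr; apply: smooth_onD => //; exact: IH.
Qed.

End SmoothOn.

(** * Row-valued maps and derivatives along lines *)

Lemma smooth_on_coord (R : realType) n (U : set 'rV[R]_n) (i : 'I_n) :
  smooth_on U (fun y : 'rV[R]_n => y 0 i : R).
Proof.
apply: smooth_onP => [x _|v]; first exact: differentiable_coord.
have -> : (fun x : 'rV[R]_n => 'D_v (fun y : 'rV_n => y 0 i : R) x) =
    cst (v 0 i).
  apply/funext => x; have /= := derive_mx (@derivable_id _ _ x v).
  by rewrite derive_id => /rowP/(_ i); rewrite mxE.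
exact: smooth_on_cst.
Qed.

Lemma differentiable_row (R : realType) (V : normedModType R) n
    (f : V -> 'rV[R]_n) x :
  (forall i, differentiable (fun y => f y 0 i) x) -> differentiable f x.
Proof.
move=> df; have -> : f = \sum_i (fun y => f y 0 i *: delta_mx 0 i : 'rV[R]_n).
  by apply/funext => y; rewrite fct_sumE [LHS]row_sum_delta.
by apply: differentiable_sum => i; apply: differentiableZl.
Qed.

Lemma smooth_on_row (R : realType) (V : normedModType R) n (U : set V)
    (f : V -> 'rV[R]_n) : open U ->
  (forall i, smooth_on U (fun y => f y 0 i)) -> smooth_on U f.
Proof.
move=> oU sf vs.
(* Smoothness of all components, rather than differentiability, is carried through the induction: it
   shows that the iterated derivative is differentiable, so that the next derivative can be taken
   componentwise. *)
suff IH : forall i, smooth_on U (fun y => iter_derive vs f y 0 i).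
  by move=> x Ux; apply: differentiable_row => i; exact: (IH i [::]).
elim: vs => //= v vs IH i.
apply: smooth_on_eq (smooth_on_derive _ _ _ v (IH i)) => // x Ux.
rewrite derive_mx ?mxE//.
by apply/diff_derivable/differentiable_row => j; exact: (IH j [::]).
Qed.

(** The two difference quotients coincide near 0, hence so do their limits. As the source spaces may
    differ, partial derivatives in a chart can be compared with derivatives in the single variable
    r. *)
Lemma derive_eq_along (R : numFieldType) (V V' W : normedModType R)
    (f : V -> W) (g : V' -> W) (a v : V) (b w : V') :
  (\forall h \near 0, f (h *: v + a) = g (h *: w + b)) ->
  'D_v f a = 'D_w g b.
Proof.
move=> fg; have fgab : f a = g b.
  by have := nbhs_singleton fg; rewrite !scale0r !add0r.
rewrite /derive; congr (lim _); rewrite eqEsubset; split;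
  apply/near_eq_cvg/cvg_within; apply: filterS fg => h /= ->;
  by rewrite fgab.
Qed.

Lemma near_line (R : numFieldType) (V : normedModType R) (A : set V) (a v : V) :
  open A -> A a -> \forall h \near 0, A (h *: v + a).
Proof.
move=> oA Aa; apply: (@near0Z _ _ v [set x | A (x + a)]).
rewrite (near_shift a)/=; apply: filterS (open_nbhs_nbhs (conj oA Aa)) => x Ax.
by rewrite /= sub0r addrNK.
Qed.

(** * The Laplacian of radial functions in product coordinates *)

Section ModelParam.
Context {R : realType} {m : nat}.
Variables (V : set 'rV[R]_m.-1) (psi : 'rV[R]_m.-1 -> 'rV[R]_m).
Hypothesis psiP : sphere_param V psi.

Lemma near_param_domain (u v : 'rV[R]_(1 + m.-1)) :
  param_domain V u -> \forall h \near 0, param_domain V (h *: v + u).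
Proof.
move=> [u0 Vu]; have [oV _ _ _ _] := psiP.
have := near_line _ _ _ _ (rsubmx v) oV Vu.
have := near_line _ _ _ _ (lsubmx v 0 0) (@open_gt R 0) u0.
apply: filterS2 => h h0 Vh; split; first by move: h0; rewrite !mxE.
by rewrite linearD linearZ.
Qed.

Lemma derive_model_param (u v : 'rV[R]_(1 + m.-1)) : V (rsubmx u) ->
  'D_v (model_param psi) u = (lsubmx v 0 0, 'D_(rsubmx v) psi (rsubmx u)).
Proof.
move=> Vu; have [_ spsi _ _ _] := psiP.
have dpsi : derivable psi (rsubmx u) (rsubmx v).
  exact/diff_derivable/(smooth_on_differentiable _ _ _ _ spsi).
apply: cvg_lim => //.
have did : derivable (@id R) (lsubmx u 0 0) (lsubmx v 0 0).
  exact: derivable_id.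
have didE := @derive_id _ _ (lsubmx u 0 0) (lsubmx v 0 0).
rewrite -[in X in _ --> X]didE; apply: cvg_trans (cvg_pair did dpsi).
apply: near_eq_cvg; apply: nearW => h.
have mE : model_param psi (h *: v + u) = (h *: lsubmx v 0 0 + lsubmx u 0 0,
    psi (h *: rsubmx v + rsubmx u)).
  by rewrite /model_param !linearD !linearZ /= !mxE.
by rewrite /= mE.
Qed.

(** The r-direction has no spherical component and the y-directions have no radial one, so the mixed
    entries vanish. The rows of the Jacobian are the images of the basis vectors, so their dot
    products form J J^T. *)
Lemma pullback_metricE (sigma : R -> R) (u : 'rV[R]_(1 + m.-1)) :
  V (rsubmx u) ->
  pullback_metric sigma psi u = block_mx 1%:M 0 0
    (sigma (lsubmx u 0 0) ^+ 2 *: ('J psi (rsubmx u) *m ('J psi (rsubmx u))^T)).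
Proof.
move=> Vu; have [_ spsi _ _ _] := psiP.
have dpsi := smooth_on_differentiable _ _ _ _ spsi Vu.
have lsub_l i : lsubmx (delta_mx 0 (lshift _ i) : 'rV[R]_(1 + m.-1)) 0 0 = 1.
  by rewrite !mxE eq_lshift !ord1 eqxx.
have rsub_l i : rsubmx (delta_mx 0 (lshift _ i) : 'rV[R]_(1 + m.-1)) = 0.
  by apply/rowP => j; rewrite !mxE eq_rlshift.
have lsub_r i : lsubmx (delta_mx 0 (rshift _ i) : 'rV[R]_(1 + m.-1)) 0 0 = 0.
  by rewrite !mxE eq_lrshift.
have rsub_r i : rsubmx (delta_mx 0 (rshift _ i) : 'rV[R]_(1 + m.-1)) =
    delta_mx 0 i.
  by apply/rowP => j; rewrite !mxE eq_rshift.
have dot0 (w : 'rV[R]_m) : dot 0 w = 0.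
  by rewrite /dot big1// => i _; rewrite mxE mul0r.
have dotw0 (w : 'rV[R]_m) : dot w 0 = 0.
  by rewrite /dot big1// => i _; rewrite mxE mulr0.
apply/matrixP => i j; rewrite [LHS]mxE /model_metric /partial.
rewrite !derive_model_param//.
case: (split_ordP i) => {}i ->; case: (split_ordP j) => {}j -> /=;
  rewrite ?block_mxEul ?block_mxEur ?block_mxEdl ?block_mxEdr
    ?lsub_l ?rsub_l ?lsub_r ?rsub_r ?derive0 ?dot0 ?dotw0 !mxE.
- by rewrite !ord1 mulr1 mulr0 addr0.
- by rewrite !mulr0 addr0.
- by rewrite !mul0r mulr0 addr0.
- rewrite mul0r add0r; congr (_ * _); apply: eq_bigr => l _.
  by rewrite !deriveEjacobian// -!rowE !mxE.
Qed.

Section Laplacian.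
Variable sigma : R -> R.
Hypothesis sigma_gt0 : forall r : R, 0 < r -> 0 < sigma r.
Variable u : 'rV[R]_(1 + m.-1).
Hypothesis Du : param_domain V u.

Let gram := 'J psi (rsubmx u) *m ('J psi (rsubmx u))^T.

Lemma vol_density_pullback :
  vol_density (pullback_metric sigma psi) u =
  sigma (lsubmx u 0 0) ^+ m.-1 * Num.sqrt (\det gram).
Proof.
have [u0 Vu] := Du.
rewrite /vol_density pullback_metricE// det_ublock det1 mul1r detZ.
rewrite sqrtrM; last by rewrite exprn_ge0// sqr_ge0.
(* Scaling a block of size m - 1 by sigma^2 contributes sigma^(2(m-1)), whose root is sigma^(m-1)
   because sigma > 0. *)
rewrite -exprM mulnC exprM sqrtr_sqr.
by rewrite ger0_norm// exprn_ge0// ltW// sigma_gt0.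
Qed.

Lemma gram_gt0 : 0 < \det gram.
Proof.
by have [_ _ _ _ imm] := psiP; have [_ /imm] := Du; exact: det_gram_gt0.
Qed.

Lemma gradient_radial (phi : 'rV[R]_(1 + m.-1) -> R) (F : R -> R) :
  (forall v, param_domain V v -> phi v = F (lsubmx v 0 0)) ->
  gradient (pullback_metric sigma psi) phi u =
  row_mx ('D_1 F (lsubmx u 0 0))%:M 0.
Proof.
move=> phiF; have [u0 Vu] := Du.
have phi_r i : partial (rshift 1 i) phi u = 0.
  (* The value 0 is written as the derivative of a constant, so that [derive_eq_along] applies:
     moving in a spherical direction leaves r, hence [phi], unchanged. *)
  rewrite /partial -(derive_cst (F (lsubmx u 0 0)) (0 : R) (0 : R)).
  apply: derive_eq_along.
  apply: filterS (near_param_domain _ (delta_mx 0 (rshift 1 i)) Du)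
    => h /phiF ->.
  by rewrite linearD linearZ /= !mxE eq_lrshift mulr0 add0r.
have phi_l i : partial (lshift m.-1 i) phi u = 'D_1 F (lsubmx u 0 0).
  apply: derive_eq_along.
  apply: filterS (near_param_domain _ (delta_mx 0 (lshift _ i)) Du)
    => h /phiF ->.
  by rewrite linearD linearZ /= !mxE eq_lshift !ord1.
have unitG : block_mx (1%:M : 'M[R]_1) 0 0
    (sigma (lsubmx u 0 0) ^+ 2 *: gram) \in unitmx.
  rewrite unitmxE det_ublock det1 mul1r detZ unitfE mulf_neq0 ?expf_neq0//.
    by rewrite gt_eqF// sigma_gt0.
  by rewrite gt_eqF// gram_gt0.
apply/rowP => i; rewrite mxE big_split_ord /= big_ord1.
rewrite [X in _ + X]big1 ?addr0 => [|j _]; last by rewrite phi_r mulr0.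
rewrite phi_l pullback_metricE// invmx_block_diag// invmx1.
case: (split_ordP i) => {}i ->; rewrite ?row_mxEl ?row_mxEr.
  by rewrite block_mxEul !ord1 !mxE mul1r mulr1n.
by rewrite block_mxEdl !mxE mul0r.
Qed.
End Laplacian.

(* Stated through G = w F', w = sigma^(m-1), so that no second derivative of F
   has to be mentioned. *)
Lemma coord_laplacian_radial (sigma : R -> R)
    (sigma_gt0 : forall r : R, 0 < r -> 0 < sigma r)
    (phi : 'rV[R]_(1 + m.-1) -> R) (F G H : R -> R) (u : 'rV[R]_(1 + m.-1)) :
  (forall v, param_domain V v -> phi v = F (lsubmx v 0 0)) ->
  antiderivative (fun r => G r / sigma r ^+ m.-1) F ->
  antiderivative (fun r => H r * sigma r ^+ m.-1) G ->
  param_domain V u ->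
  coord_laplacian (pullback_metric sigma psi) phi u = H (lsubmx u 0 0).
Proof.
move=> phiF dF dG Du; have [u0 Vu] := Du.
rewrite /coord_laplacian /divergence vol_density_pullback//.
set g := \det _.
have g_neq0 : Num.sqrt g != 0 by rewrite gt_eqF// sqrtr_gt0 gram_gt0.
have w_neq0 r : 0 < r -> sigma r ^+ m.-1 != 0.
  by move=> r0; rewrite expf_neq0// gt_eqF// sigma_gt0.
have gradE v : param_domain V v ->
    gradient (pullback_metric sigma psi) phi v =
    row_mx (G (lsubmx v 0 0) / sigma (lsubmx v 0 0) ^+ m.-1)%:M 0.
  move=> Dv; rewrite (gradient_radial _ _ _ Dv _ _ phiF)//.
  by have [v0 _] := Dv; have [_ ->] := dF _ v0.
rewrite big_split_ord /= big_ord1 [X in _ + X]big1 ?addr0 => [|j _]; last first.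
  rewrite /partial -(derive_cst (0 : R) (0 : R) (0 : R)).
  apply: derive_eq_along.
  apply: filterS (near_param_domain _ (delta_mx 0 (rshift 1 j)) Du) => h Dh.
  by rewrite gradE// row_mxEr mxE mulr0.
(* In the r-direction the spherical factor sqrt g is constant, and the w of the density cancels the
   1/w in F' = G/w. What is differentiated is sqrt g times G, and G' = H w. *)
rewrite /partial [X in _ * X](_ : _ = 'D_1 (Num.sqrt g \*o G) (lsubmx u 0 0)).
  have [dGu dGuE] := dG _ u0.
  rewrite deriveMl// dGuE.
  have := w_neq0 _ u0; set b := sigma _ ^+ _ => b0.
  by field; rewrite b0 g_neq0.
apply: derive_eq_along.
apply: filterS (near_param_domain _ (delta_mx 0 (lshift _ 0)) Du) => h Dh.
rewrite gradE// vol_density_pullback// row_mxEl [_%:M _ _]mxE eqxx mulr1n.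
have [h0 _] := Dh; move: h0.
have -> : rsubmx (h *: delta_mx 0 (lshift m.-1 0) + u) = rsubmx u.
  by apply/rowP => j; rewrite !mxE eq_rlshift mulr0 add0r.
have -> : lsubmx (h *: delta_mx 0 (lshift m.-1 0) + u) 0 0 =
    h *: 1 + lsubmx u 0 0.
  by rewrite !mxE eq_lshift.
move=> h0; rewrite -/g -mulrA mulrCA; congr (_ * _).
by rewrite mulrC divfK// w_neq0.
Qed.

End ModelParam.

(** Differentiating in direction v along the line amounts to differentiating g in direction v e, so
    iterated derivatives of the restriction are restrictions of iterated derivatives. *)
Lemma smooth_on_line (R : realType) (V W : normedModType R) (U : set V)
    (g : V -> W) (e a : V) :
  smooth_on U g ->
  smooth_on [set h : R | U (h *: e + a)] (fun h : R => g (h *: e + a)).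
Proof.
move=> sg vs x Ux.
have -> : iter_derive vs (fun h : R => g (h *: e + a)) =
    iter_derive [seq v *: e | v <- vs] g \o (fun h : R => h *: e + a).
  elim: vs => //= v vs ->; apply/funext => y /=; apply: derive_eq_along.
  by apply: (@filterE _ (nbhs (0 : R))) => h /=; rewrite scalerDl scalerA addrA.
apply: differentiable_comp; last exact: sg.
by apply: differentiableD.
Qed.

(** * Stereographic projection as a chart of the sphere *)

Section Stereographic.
Context {R : realType} {k : nat}.
Implicit Type y : 'rV[R]_k.

Let q y : R := 1 + \sum_i y 0 i ^+ 2.

(** Inverse of the projection from the pole (1, 0, ..., 0), with [q y] = 1 + |y|^2; the first
    coordinate equals (|y|^2 - 1)/(|y|^2 + 1). *)
Definition stereographic y : 'rV[R]_k.+1 :=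
  row_mx (1 - 2 / q y)%:M ((2 / q y) *: y) : 'rV[R]_(1 + k).

Let q_gt0 y : 0 < q y.
Proof. by rewrite ltr_wpDr// sumr_ge0// => i _; rewrite sqr_ge0. Qed.

Lemma stereographic_pole y :
  stereographic y 0 (lshift k (0 : 'I_1)) = 1 - 2 / q y.
Proof. by rewrite /stereographic (@row_mxEl _ 1 1) mxE eqxx mulr1n. Qed.

Lemma stereographic_coord y i :
  stereographic y 0 (rshift 1 i) =
  y 0 i * (1 - stereographic y 0 (lshift k (0 : 'I_1))).
Proof.
rewrite stereographic_pole /stereographic (@row_mxEr _ 1 1) mxE.
by rewrite opprB addrCA subrr addr0 mulrC.
Qed.

Lemma stereographic_pole_neq1 y :
  1 - stereographic y 0 (lshift k (0 : 'I_1)) != 0.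
Proof.
rewrite stereographic_pole opprB addrCA subrr addr0.
by rewrite mulf_neq0// ?invr_eq0 ?gt_eqF.
Qed.

Lemma smooth_stereographic : smooth_on setT stereographic.
Proof.
have oT : open [set: 'rV[R]_k] by exact: openT.
have spole : smooth_on setT (fun y => stereographic y 0 (lshift k (0 : 'I_1))).
  under eq_fun do rewrite stereographic_pole.
  apply: smooth_onD => //; first exact: smooth_on_cst.
  under eq_fun do rewrite -mulNr.
  apply: smooth_onM => //; first exact: smooth_on_cst.
  apply: smooth_onV => // [y _|]; first by rewrite gt_eqF.
  apply: smooth_onD => //; first exact: smooth_on_cst.
  by apply: smooth_on_sum => // i; apply: smooth_onX => //;
    exact: smooth_on_coord.
apply: smooth_on_row => // i.
have [{}i ->|{}i ->] := split_ordP (i : 'I_(1 + k)); first by rewrite !ord1.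
under eq_fun do rewrite stereographic_coord.
apply: smooth_onM => //; first exact: smooth_on_coord.
apply: smooth_onD => //; first exact: smooth_on_cst.
under eq_fun do rewrite -mulN1r.
by apply: smooth_onM => //; exact: smooth_on_cst.
Qed.

(* All three geometric properties rest on psi_i = y_i (1 - psi_0), where
   1 - psi_0 = 2 / (1 + |y|^2) does not vanish. *)
Lemma sphere_param_stereographic : sphere_param (m := k.+1) setT stereographic.
Proof.
split; [exact: openT|exact: smooth_stereographic| | |].
- move=> y z _ _ yz; apply/rowP => i.
  have := stereographic_coord y i.
  by rewrite yz stereographic_coord => /(mulIf (stereographic_pole_neq1 z)).
- move=> y _; rewrite /unit_sphere /= /dot.
  rewrite (@big_split_ord _ _ _ 1 k) /= big_ord1 stereographic_pole.
  under eq_bigr => i _.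
    rewrite stereographic_coord stereographic_pole opprB addrCA subrr addr0.
    rewrite -expr2 exprMn mulrC.
    over.
  rewrite -mulr_sumr (_ : \sum_i _ = q y - 1); last by rewrite /q addrC addKr.
  have : q y != 0 by rewrite gt_eqF.
  by move=> q0; field.
(* A vector v killed by the Jacobian is a direction in which every psi_i has derivative 0.
   Differentiating psi_i = y_i (1 - psi_0) in that direction leaves v_i (1 - psi_0) = 0. *)
- move=> y _; apply: inj_row_free => v.
  have dpsi := smooth_on_differentiable _ _ _ y smooth_stereographic I.
  have dcoord i : derivable (fun z => stereographic z 0 i : R) y v.
    by have /derivable_mxP := diff_derivable (v := v) dpsi; apply.
  rewrite -deriveEjacobian// derive_mx; last exact: diff_derivable.
  move=> /matrixP dpsi0; apply/rowP => i.
  have := dpsi0 0 (lshift k (0 : 'I_1)); rewrite !mxE => dpole.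
  have := dpsi0 0 (rshift 1 i); rewrite !mxE.
  under [X in derive X]eq_fun do rewrite stereographic_coord.
  have dp : is_derive y v
      (fun z : 'rV[R]_k => 1 - stereographic z 0 (lshift k (0 : 'I_1)) : R) 0.
    apply: (is_derive_eq (is_deriveB (is_derive_cst (1 : R) y v)
      (derivableP (dcoord _)))).
    by rewrite dpole subrr.
  have dc : is_derive y v (fun z : 'rV[R]_k => z 0 i : R) (v 0 i).
    split; first exact/diff_derivable/differentiable_coord.
    have /= := derive_mx (@derivable_id _ _ y v).
    by rewrite derive_id => /rowP/(_ i); rewrite mxE.
  have [_ ->] := is_deriveM dc dp.
  rewrite scaler0 add0r => /eqP.
  by rewrite mulf_eq0 (negPf (stereographic_pole_neq1 y)) => /eqP.
Qed.

End Stereographic.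

(** * Antiderivatives and reduction to one variable *)

Lemma antiderivative_unique (R : realType) (g G1 G2 : R -> R) :
  antiderivative g G1 -> antiderivative g G2 ->
  exists c, forall r, 0 < r -> G1 r = c + G2 r.
Proof.
(* The constant is the value of the difference at the base point 1; by the mean value theorem the
   difference is constant on the half-line. *)
move=> dG1 dG2; exists ((G1 - G2) 1) => r r0.
suff -> : (G1 - G2) 1 = (G1 - G2) r by rewrite !fctE subrK.
have dD (x : R) : 0 < x -> is_derive x 1 (G1 - G2) 0.
  move=> x0; have := dG1 x x0; have := dG2 x x0 => d2 d1.
  by rewrite -(subrr (g x)); exact: is_deriveB.
have mono (a b : R) : 0 < a -> a <= b -> (G1 - G2) a = (G1 - G2) b.
  move=> a0 ab; apply/esym/eqP; rewrite -subr_eq0; apply/eqP.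
  have [x|x|x _ ->] := @MVT_segment _ (G1 - G2) (cst 0) _ _ ab.
  - by move=> /itvP xab; apply: dD; rewrite (lt_trans a0)// xab.
  - have : {in `[a, b], forall x, derivable (G1 - G2) x 1}.
      by move=> {}x /itvP xab; have [] := dD x _;
        rewrite ?(lt_le_trans a0)// xab.
    by move/derivable_within_continuous; exact.
  - by rewrite mul0r.
by have [r1|/ltW r1] := leP 1 r; [exact: mono|rewrite (mono r 1)].
Qed.

Lemma smooth_on_antiderivative (R : realType) (F : R -> R) :
  smooth_on [set r : R | 0 < r] F -> antiderivative (fun r => 'D_1 F r) F.
Proof.
move=> sF r r0; apply/derivableP/diff_derivable.
exact: smooth_on_differentiable sF r0.
Qed.

(** The ray over the point with chart coordinate y = 0 is a straight line in product coordinates, so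
    smoothness in the stereographic chart restricts to it. *)
Lemma smooth_on_radial (R : realType) (k : nat) (f : R * 'rV[R]_k.+1 -> R)
    (theta := stereographic 0) :
  smooth_on_model f -> smooth_on [set r : R | 0 < r] (fun r => f (r, theta)).
Proof.
move=> sf.
pose e : 'rV[R]_(1 + k) := delta_mx 0 (lshift k 0).
have lE (h : R) : lsubmx (h *: e + 0) 0 0 = h.
  by rewrite !mxE eq_lshift eqxx mulr1 addr0.
have rE (h : R) : rsubmx (h *: e + 0) = 0.
  by apply/rowP => j; rewrite !mxE eq_rlshift mulr0 addr0.
have := smooth_on_line _ _ _ _ _ e 0 (sf _ _ sphere_param_stereographic).
have -> : (fun h : R => (f \o model_param stereographic) (h *: e + 0)) =
    (fun r => f (r, theta)).
  by apply/funext => h; congr (f (_, stereographic _)); [exact: lE|exact: rE].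
by move=> + vs r r0; apply; split => //; rewrite lE.
Qed.

(** * Solving the biharmonic equation by four integrations *)

Theorem theorem3p2 (R : realType) (m : nat) (hm : (2 <= m)%N)
  (sigma : R -> R)
  (sigma_gt0 : forall r : R, 0 < r -> 0 < sigma r)
  (sigma_smooth : smooth_on [set r : R | 0 < r] sigma)
  (* I1 = int sigma^(1-m), I2 = int sigma^(m-1),
     I3 = int I1 sigma^(m-1), I4 = int I1^2 sigma^(m-1) *)
  (I1 I2 I3 I4 : R -> R)
  (hI1 : antiderivative (fun r => 1 / sigma r ^+ m.-1) I1)
  (hI2 : antiderivative (fun r => sigma r ^+ m.-1) I2)
  (hI3 : antiderivative (fun r => I1 r * sigma r ^+ m.-1) I3)
  (hI4 : antiderivative (fun r => I1 r ^+ 2 * sigma r ^+ m.-1) I4)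
  (f : R * 'rV[R]_m -> R) (f_radial : radial f) :
  biharmonic sigma f <->
  exists c1 c2 c3 c4 : R, forall p : R * 'rV[R]_m, model_space p ->
    let r := p.1 in
    f p = c4 + c3 * I1 r + c2 * (I1 r * I2 r - I3 r)
          + c1 * (I1 r * I3 r - I4 r).
Proof.
case: m => [//|k] in hm hI1 hI2 hI3 hI4 f f_radial *.
have w_neq0 (r : R) : 0 < r -> sigma r ^+ k != 0.
  by move=> r0; rewrite expf_neq0// gt_eqF// sigma_gt0.
have dI1 (c1 c2 : R) :
    antiderivative (fun r => c1 / sigma r ^+ k) (fun r => c2 + c1 * I1 r).
  move=> r r0; have := hI1 r r0 => /= d1.
  apply: is_derive_eq (is_deriveD (is_derive_cst c2 r 1) (is_deriveZ c1 d1)) _.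
  by rewrite add0r /GRing.scale /= mul1r.
have dG (c1 c2 c3 : R) :
    antiderivative (fun r => (c2 + c1 * I1 r) * sigma r ^+ k)
    (fun r => c3 + c2 * I2 r + c1 * I3 r).
  move=> r r0; have := hI2 r r0; have := hI3 r r0 => /= d3 d2.
  apply: is_derive_eq (is_deriveD (is_deriveD (is_derive_cst c3 r 1)
    (is_deriveZ c2 d2)) (is_deriveZ c1 d3)) _.
  by rewrite add0r /GRing.scale /=; ring.
have dF (c1 c2 c3 c4 : R) :
    antiderivative (fun r => (c3 + c2 * I2 r + c1 * I3 r) / sigma r ^+ k)
    (fun r => c4 + c3 * I1 r + c2 * (I1 r * I2 r - I3 r)
              + c1 * (I1 r * I3 r - I4 r)).
  move=> r r0; have := hI1 r r0; have := hI2 r r0; have := hI3 r r0.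
  have := hI4 r r0 => /= d4 d3 d2 d1.
  apply: is_derive_eq (is_deriveD (is_deriveD (is_deriveD (is_derive_cst c4 r 1)
    (is_deriveZ c3 d1)) (is_deriveZ c2 (is_deriveB (is_deriveM d1 d2) d3)))
    (is_deriveZ c1 (is_deriveB (is_deriveM d1 d3) d4))) _.
  rewrite add0r /GRing.scale /=.
  (* By the product rule the terms I1 w cancel in (I1 I2 - I3)' = I2/w, and the terms I1^2 w in (I1
     I3 - I4)' = I3/w. *)
  by field; exact: w_neq0.
split=> [[h [Lf Lh]]|[c1 [c2 [c3 [c4 fE]]]]]; last first.
  (* The Laplacian of f is c2 + c1 I1. For its own Laplacian the flux w (c2 + c1 I1)' is the
     constant c1, with derivative 0. *)
  exists (fun p => c2 + c1 * I1 p.1); split=> V psi psiP u Du.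
    symmetry; apply: (coord_laplacian_radial _ _ psiP _ _ _ _ _ _ _ _
      (dF c1 c2 c3 c4) (dG c1 c2 c3)) => //.
    move=> v [v0 Vv]; have [_ _ _ psi1 _] := psiP.
    by rewrite /comp fE//; split => //; exact: psi1.
  symmetry; apply: (coord_laplacian_radial _ _ psiP _ _ _ _ (cst c1) (cst 0) _ _
    (dI1 c1 c2)) => //.
  move=> r r0; rewrite mul0r; exact: is_derive_cst.
have [sf f_eq] := f_radial.
have psiP := @sphere_param_stereographic R k.
set theta := @stereographic R k 0.
have theta1 : unit_sphere theta by have [_ _ _ + _] := psiP; apply.
(* For the converse, f is read along one ray. [G] and [G'] are the fluxes w F' and w H', so [G'] is
   not the derivative of [G]; [H] is the candidate for the Laplacian. *)
pose w r := sigma r ^+ k.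
pose F r := f (r, theta).
pose G r := w r * 'D_1 F r.
pose H r := (w r)^-1 * 'D_1 G r.
pose G' r := w r * 'D_1 H r.
have o_pos : open [set r : R | 0 < r] := @open_gt R 0.
have sw : smooth_on [set r : R | 0 < r] w by exact: smooth_onX.
have sF : smooth_on [set r : R | 0 < r] F by exact: smooth_on_radial.
have sG : smooth_on [set r : R | 0 < r] G.
  by apply: smooth_onM => //; exact: smooth_on_derive.
have sH : smooth_on [set r : R | 0 < r] H.
  by apply: smooth_onM => //; [exact: smooth_onV|exact: smooth_on_derive].
have sG' : smooth_on [set r : R | 0 < r] G'.
  by apply: smooth_onM => //; exact: smooth_on_derive.
have anti_eq (g g' G0 : R -> R) : (forall r, 0 < r -> g r = g' r) ->
    antiderivative g G0 -> antiderivative g' G0.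
  by move=> gg' dG0 r r0; rewrite -gg'//; exact: dG0.
have dF' : antiderivative (fun r => G r / w r) F.
  apply: anti_eq (smooth_on_antiderivative _ _ sF) => r /w_neq0 r0.
  by rewrite /G mulrC mulKf.
have dG' : antiderivative (fun r => H r * w r) G.
  apply: anti_eq (smooth_on_antiderivative _ _ sG) => r /w_neq0 r0.
  by rewrite /H mulrC mulVKf.
have dH : antiderivative (fun r => G' r / w r) H.
  apply: anti_eq (smooth_on_antiderivative _ _ sH) => r /w_neq0 r0.
  by rewrite /G' mulrC mulKf.
have dG'' : antiderivative (fun r => (w r)^-1 * 'D_1 G' r * w r) G'.
  apply: anti_eq (smooth_on_antiderivative _ _ sG') => r /w_neq0 r0.
  by rewrite mulrC mulVKf.
have fF (v : 'rV[R]_(1 + k)) : @param_domain R k.+1 setT v ->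
    (f \o model_param stereographic) v = F (lsubmx v 0 0).
  move=> [v0 _]; apply: f_eq => //; split => //.
  by have [_ _ _ + _] := psiP; apply.
(* [h] is not assumed radial: it depends only on r in this chart because it equals the Laplacian of
   the radial function f there. *)
have hH (v : 'rV[R]_(1 + k)) : @param_domain R k.+1 setT v ->
    (h \o model_param stereographic) v = H (lsubmx v 0 0).
  move=> Dv; rewrite [LHS](Lf _ _ psiP _ Dv).
  exact: (coord_laplacian_radial _ _ psiP _ _ _ _ _ _ _ fF dF' dG').
have [c1 G'E] : exists c1, forall r, 0 < r -> G' r = c1 + 0.
  apply: (antiderivative_unique _ (cst 0) _ (cst 0)); last first.
    by move=> r _; exact: is_derive_cst.
  apply: (anti_eq _ _ _ _ dG'') => r r0.
  (* Each r > 0 is reached by the chart point (r, 0), where the second Laplacian vanishes; this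
     makes the derivative of [G'] zero. *)
  pose u : 'rV[R]_(1 + k) := row_mx r%:M 0.
  have ur : lsubmx u 0 0 = r by rewrite row_mxKl mxE eqxx mulr1n.
  have Du : @param_domain R k.+1 setT u by split => //; rewrite ur.
  have := Lh _ _ psiP u Du.
  rewrite (coord_laplacian_radial _ _ psiP _ _ _ _ _ _ _ hH dH dG'')// ur => <-.
  by rewrite mul0r.
(* From here on each comparison function is taken with integration constant 0, and
   [antiderivative_unique] supplies the new constant. *)
have [c2 HE] : exists c2, forall r, 0 < r -> H r = c2 + (0 + c1 * I1 r).
  apply: antiderivative_unique (dI1 c1 0).
  by apply: anti_eq dH => r r0; rewrite G'E// addr0.
have [c3 GE] : exists c3, forall r, 0 < r ->
    G r = c3 + (0 + c2 * I2 r + c1 * I3 r).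
  apply: antiderivative_unique (dG c1 c2 0).
  by apply: anti_eq dG' => r r0; rewrite HE// add0r.
have [c4 FE] : exists c4, forall r, 0 < r -> F r = c4 +
    (0 + c3 * I1 r + c2 * (I1 r * I2 r - I3 r) + c1 * (I1 r * I3 r - I4 r)).
  apply: antiderivative_unique (dF c1 c2 c3 0).
  by apply: anti_eq dF' => r r0; rewrite GE// add0r addrA.
exists c1, c2, c3, c4 => p [p0 p1] /=.
by rewrite (f_eq p (p.1, theta))// [LHS]FE// add0r !addrA.
Qed.
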